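(* If $D$ is an $\alpha$-critical Deming graph, then $D$ is an even subdivision of $K_4$.
   Context: Graphs are finite and simple. For a graph $H$, $n(H)$ is its order, $\alpha(H)$ its independence number and $\nu(H)$ its matching number. $H$ is KE (König-Egerváry) if $\alpha(H)+\nu(H)=n(H)$; the null graph is KE. A graph $G$ is $\alpha$-critical if $\alpha(G-xy)=\alpha(G)+1$ for each edge $xy$ of $G$, where $G-xy$ is the graph obtained by deleting the edge $xy$. $T$ is the graph on 6 vertices consisting of two vertex-disjoint triangles together with a single edge joining a vertex of one to a vertex of the other. An even subdivision of a graph is obtained by subdividing each edge an even number (possibly zero) of times, i.e. replacing each edge by a path of odd length. A Deming-$K_4$ graph is a graph $K$ that contains a spanning even subdivision of $K_4$ and such that $K-\{x,y\}$ (delete both vertices) is KE for every edge $xy$ of $K$ that lies in at least one perfect matching of $K$. A Deming-BP graph is a graph $B$ that contains a spanning even subdivision of $T$ and such that $B-\{x,y\}$ is KE for every edge $xy$ of $B$ that lies in at least one perfect matching of $B$. A Deming graph is a graph that is a Deming-$K_4$ graph or a Deming-BP graph. *)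

(* Defs.v *)
From mathcomp Require Import all_boot.

Set Implicit Arguments.
Unset Strict Implicit.
Unset Printing Implicit Defensive.

Record sgraph (V : finType) := SGraph {
  adj :> rel V;
  adj_sym : symmetric adj;
  adj_irrefl : irreflexive adj
}.

Section Graph.
Variables (V : finType) (G : sgraph V).

Definition independent (S : {set V}) : bool :=
  [forall x in S, forall y in S, ~~ G x y].

Definition indep_number : nat := \max_(S : {set V} | independent S) #|S|.

Definition edges : {set {set V}} :=
  [set e : {set V} | [exists x, exists y, G x y && (e == [set x; y])]].

Definition matching (M : {set {set V}}) : bool :=
  (M \subset edges) && trivIset M.

Definition matching_number : nat := \max_(M : {set {set V}} | matching M) #|M|.

Definition perfect_matching (M : {set {set V}}) : bool :=
  matching M && (cover M == [set: V]).

Definition konig_egervary : Prop := indep_number + matching_number = #|V|.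

Definition del_edge_rel (x y : V) : rel V :=
  [rel u v | G u v && ([set u; v] != [set x; y])].

Lemma del_edge_sym x y : symmetric (del_edge_rel x y).
Proof. by move=> u v; rewrite /del_edge_rel /= adj_sym setUC. Qed.

Lemma del_edge_irrefl x y : irreflexive (del_edge_rel x y).
Proof. by move=> u; rewrite /del_edge_rel /= adj_irrefl. Qed.

Definition del_edge (x y : V) : sgraph V :=
  SGraph (del_edge_sym x y) (del_edge_irrefl x y).

Definition induced_rel (A : {set V}) : rel {z : V | z \in A} :=
  [rel u v | G (val u) (val v)].

Lemma induced_sym A : symmetric (@induced_rel A).
Proof. by move=> u v; rewrite /induced_rel /= adj_sym. Qed.

Lemma induced_irrefl A : irreflexive (@induced_rel A).
Proof. by move=> u; rewrite /induced_rel /= adj_irrefl. Qed.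

Definition induced (A : {set V}) : sgraph {z : V | z \in A} :=
  SGraph (@induced_sym A) (@induced_irrefl A).

End Graph.

Definition alpha_critical (V : finType) (G : sgraph V) : Prop :=
  forall x y : V, G x y ->
    indep_number (del_edge G x y) = (indep_number G).+1.

(* [f] places the branch vertices and [p x y] lists the interior vertices, from
   [f x] to [f y], of the path that replaces the edge [xy] of [H]; that path has
   [(size (p x y)).+1] edges.  The values of [p] at non-adjacent pairs are
   irrelevant. *)
Definition even_subdivision (U V : finType) (H : sgraph U) (G : sgraph V)
    : Prop :=
  exists (f : U -> V) (p : U -> U -> seq V),
    let full x y := f x :: rcons (p x y) (f y) in
    [/\ injective f,
        (forall x y, H x y ->
           [/\ sorted G (full x y), uniq (full x y), ~~ odd (size (p x y)),
               p y x = rev (p x y) & forall z, f z \notin p x y]),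
        (forall x y x' y' v, H x y -> H x' y' ->
           v \in p x y -> v \in p x' y' -> [set x; y] = [set x'; y']),
        (forall v, (exists x, v = f x) \/
                   (exists x y, H x y /\ v \in p x y)) &
        (forall u v, G u v -> exists x y, H x y /\ infix [:: u; v] (full x y))].

Definition has_spanning_even_subdivision (U V : finType)
    (H : sgraph U) (G : sgraph V) : Prop :=
  exists S : sgraph V, subrel S G /\ even_subdivision H S.

Definition K4_rel : rel 'I_4 := [rel i j : 'I_4 | i != j].

Lemma K4_sym : symmetric K4_rel.
Proof. by move=> i j; rewrite /K4_rel /= eq_sym. Qed.

Lemma K4_irrefl : irreflexive K4_rel.
Proof. by move=> i; rewrite /K4_rel /= eqxx. Qed.

Definition K4 : sgraph 'I_4 := SGraph K4_sym K4_irrefl.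

(* Triangles 0,1,2 and 3,4,5, joined by the edge 23. *)
Definition T_rel : rel 'I_6 :=
  [rel i j : 'I_6 | (i != j) &&
     [|| (i < 3) == (j < 3), (i == 2 :> nat) && (j == 3 :> nat)
       | (i == 3 :> nat) && (j == 2 :> nat)]].

Lemma T_sym : symmetric T_rel.
Proof.
move=> i j; rewrite /T_rel /= eq_sym [(j < 3) == _]eq_sym orbA -orbA; congr (_ && (_ || _)).
by rewrite orbC ![(j == _ :> nat) && _]andbC.
Qed.

Lemma T_irrefl : irreflexive T_rel.
Proof. by move=> i; rewrite /T_rel /= eqxx. Qed.

Definition T_graph : sgraph 'I_6 := SGraph T_sym T_irrefl.

Definition deming_condition (V : finType) (G : sgraph V) : Prop :=
  forall x y : V, G x y ->
    (exists M : {set {set V}}, perfect_matching G M /\ [set x; y] \in M) ->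
    konig_egervary (induced G (~: [set x; y])).

Definition deming_K4 (V : finType) (G : sgraph V) : Prop :=
  has_spanning_even_subdivision K4 G /\ deming_condition G.

Definition deming_BP (V : finType) (G : sgraph V) : Prop :=
  has_spanning_even_subdivision T_graph G /\ deming_condition G.

Definition deming (V : finType) (G : sgraph V) : Prop :=
  deming_K4 G \/ deming_BP G.

(* Main.v *)
Require Import Defs.
From mathcomp Require Import all_boot.
From mathcomp Require Import zify.

Set Implicit Arguments.
Unset Strict Implicit.
Unset Printing Implicit Defensive.

(** The theorem reduces to comparing independence numbers with half the order.
    Write [n] for the order of [D] and let [S] be a spanning even subdivision
    of [H] in [D], where [H] is [K4] or the graph [T] of two triangles joined
    by a bridge.

    Lower bound, [n <= 2 * alpha(D) + 2].  A perfect matching of [H] lifts to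
    one of [S]: along the path replacing a matched edge every other edge is
    taken starting from the end, along the other paths the interior vertices
    are paired off.  So [D] has an edge [xy] that lies in a perfect matching,
    and [D - {x, y}] is König-Egerváry.  As a matching covers at most [n - 2]
    vertices there, the independence number of [D - {x, y}], hence of [D], is
    at least [(n - 2) / 2] ([deming_subdivision_indep_number_ge]).

    Upper bound, [2 * alpha(S) + |U| <= 2 * alpha(H) + n], with [U] the vertex
    set of [H].  An independent set meets the interior of a subdivided edge in
    at most half of its vertices, and in at least one vertex fewer if it
    contains both ends.  Let [X] be the set of branch vertices that are used,
    and [e(X)] the number of edges of [H] inside [X].  The total is at most
    [|X| - e(X) + (n - |U|) / 2], and [|X| <= alpha(H) + e(X)] in every graph
    ([card_le_indep_number_arcs]).  The same count shows that deleting one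
    well-chosen edge of a subdivided edge [x0 y0] costs no more than deleting
    [x0 y0] from [H] ([indep_number_subdivision_del]).

    For [K4] the two bounds give [alpha(S) <= alpha(D)].  An edge of [D] that
    is not in [S] could then be deleted without raising [alpha] above
    [alpha(S)], against criticality, so [D] is [S].  For [T], deleting the
    bridge leaves independence number 2, so by the same bounds some edge of
    the subdivided bridge can be deleted from [D] without raising [alpha];
    this case does not occur. *)

(** * Lists and pairs *)

Lemma uniq_flatten_map (I T : eqType) (s : I -> seq T) (es : seq I) :
    uniq es -> {in es, forall e, uniq (s e)} ->
    {in es &, forall e e' x, x \in s e -> x \in s e' -> e = e'} ->
  uniq (flatten (map s es)).
Proof.
elim: es => [|e es IH] //= /andP[e_es uniq_es] uniq_s disj_s.
rewrite cat_uniq uniq_s ?mem_head //= IH //; first last.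
- by move=> a b a_es b_es; apply: disj_s; rewrite inE ?a_es ?b_es orbT.
- by move=> a a_es; apply: uniq_s; rewrite inE a_es orbT.
rewrite andbT; apply/hasPn => x /flatten_mapP[e' e'_es x_e'].
apply: contra e_es => x_e.
by rewrite (disj_s e e' _ _ x x_e x_e') // inE ?eqxx ?e'_es ?orbT.
Qed.

Lemma set2_eq (T : finType) (a b c d : T) :
  [set a; b] = [set c; d] -> (a = c /\ b = d) \/ (a = d /\ b = c).
Proof.
move=> E.
have: (a \in [set c; d]) && (b \in [set c; d]) by rewrite -E set21 set22.
have: (c \in [set a; b]) && (d \in [set a; b]) by rewrite E set21 set22.
rewrite !inE => /andP[/orP[]/eqP ? /orP[]/eqP ?] /andP[/orP[]/eqP ? /orP[]/eqP ?];
  by [left; split; congruence | right; split; congruence].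
Qed.

Lemma pair_seq_ind (T : Type) (P : seq T -> Prop) :
  P [::] -> (forall a, P [:: a]) -> (forall a b s, P s -> P [:: a, b & s]) ->
  forall s, P s.
Proof.
move=> P0 P1 P2 s.
suff: P s /\ forall a, P (a :: s) by case.
by elim: s => [|b s [IH1 IH2]]; split=> // a; apply: P2.
Qed.

(** * Independence number *)

Section Independence.
Variables (V : finType) (G : sgraph V).

Lemma independentP (S : {set V}) :
  reflect {in S &, forall x y, ~~ G x y} (independent G S).
Proof.
apply: (iffP forall_inP) => [indS x y xS yS|indS x xS].
  exact: (forall_inP (indS x xS)).
by apply/forall_inP => y; apply: indS.
Qed.

Lemma indep_number_ge (S : {set V}) : independent G S -> #|S| <= indep_number G.
Proof. by move=> indS; rewrite /indep_number (leq_bigmax_cond _ indS). Qed.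

Lemma indep_number_le n :
  (forall S : {set V}, independent G S -> #|S| <= n) -> indep_number G <= n.
Proof. by move=> le_n; apply/bigmax_leqP. Qed.

Lemma indep_number_attained :
  exists2 S : {set V}, independent G S & indep_number G = #|S|.
Proof.
have: 0 < #|independent G|.
  by apply/card_gt0P; exists set0; apply/independentP => x y; rewrite inE.
by case/(eq_bigmax_cond (fun S : {set V} => #|S|)) => S; exists S.
Qed.

End Independence.

Lemma indep_number_subrel (V : finType) (G G' : sgraph V) :
  subrel G G' -> indep_number G' <= indep_number G.
Proof.
move=> sGG'; apply: indep_number_le => S /independentP indS.
apply: indep_number_ge; apply/independentP => x y xS yS.
by apply: contra (indS x y xS yS); apply: sGG'.
Qed.

Lemma indep_number_induced (V : finType) (G : sgraph V) (A : {set V}) :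
  indep_number (induced G A) <= indep_number G.
Proof.
apply: indep_number_le => S /independentP indS.
rewrite -(card_imset _ val_inj); apply: indep_number_ge.
by apply/independentP => _ _ /imsetP[x xS ->] /imsetP[y yS ->]; apply: indS.
Qed.

(** Deleting an edge of [D] outside [S] leaves a graph that still contains [S],
    so its independence number is at most that of [S]. *)
Lemma alpha_critical_subrel (V : finType) (D S : sgraph V) :
  alpha_critical D -> subrel S D -> indep_number S <= indep_number D ->
  subrel D S.
Proof.
move=> critD sSD le_SD u v Duv; apply/idPn => nSuv.
suff: indep_number (del_edge D u v) <= indep_number D by rewrite critD // ltnn.
apply: leq_trans le_SD; apply: indep_number_subrel => a b Sab /=.
rewrite /del_edge_rel /= sSD //=; apply/eqP => /set2_eq.
by case=> -[Ea Eb]; case/negP: nSuv; rewrite -Ea -Eb // adj_sym.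
Qed.

Lemma even_subdivision_eqrel (U V : finType) (H : sgraph U) (S D : sgraph V) :
  subrel S D -> subrel D S -> even_subdivision H S -> even_subdivision H D.
Proof.
move=> sSD sDS [f [p [injf paths disj cov edge]]]; exists f, p; split=> //.
- move=> x y /paths[srt uq ev rv nf]; split=> //.
  exact: sub_sorted srt.
- by move=> u v /sDS; apply: edge.
Qed.

(** * Matchings *)

Section Matching.
Variables (V : finType) (G : sgraph V).

Lemma card_edge (e : {set V}) : e \in edges G -> #|e| = 2.
Proof.
rewrite inE => /existsP[x /existsP[y /andP[Gxy /eqP->]]].
rewrite cards2; suff ->: x != y by [].
by apply: contraTneq Gxy => ->; rewrite adj_irrefl.
Qed.

Lemma matching_number_le : 2 * matching_number G <= #|V|.
Proof.
suff: matching_number G <= #|V| %/ 2 by lia.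
apply/bigmax_leqP => M /andP[/subsetP sM /eqP tM].
have: \sum_(e in M) #|e| <= #|V| by rewrite tM max_card.
rewrite (eq_bigr (fun=> 2)) => [|e /sM/card_edge //].
by rewrite sum_nat_const; lia.
Qed.

Fixpoint paired (s : seq V) : bool :=
  if s is a :: t then
    if t is b :: s' then G a b && paired s' else false
  else true.

Lemma paired_sorted s : sorted G s -> ~~ odd (size s) -> paired s.
Proof.
elim/pair_seq_ind: s => [|a|a b s IH] //=; rewrite negbK => /andP[-> srt] ev /=.
by apply: IH => //; apply: path_sorted srt.
Qed.

Lemma paired_cat s t : paired s -> paired t -> paired (s ++ t).
Proof. by elim/pair_seq_ind: s => [|a|a b s IH] //= /andP[-> ps] /=; apply: IH. Qed.

Lemma paired_flatten_map (I : eqType) (s : I -> seq V) (es : seq I) :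
  {in es, forall e, paired (s e)} -> paired (flatten (map s es)).
Proof.
elim: es => //= e es IH ps; apply: paired_cat; first by rewrite ps ?mem_head.
by apply: IH => e' e'_es; rewrite ps // inE e'_es orbT.
Qed.

Lemma matching_of_paired s : paired s -> uniq s ->
  exists2 M, matching G M & cover M = [set x in s].
Proof.
elim/pair_seq_ind: s => [|a|a b s IH] //=.
  move=> _ _; exists set0; last by rewrite /cover big_set0; apply/setP => x; rewrite !inE.
  by rewrite /matching sub0set /trivIset /cover !big_set0 cards0.
rewrite inE negb_or => /andP[Gab ps] /and3P[/andP[_ a_s] b_s us].
have [M /andP[sM tM] cM] := IH ps us.
exists ([set a; b] |: M).
  rewrite /matching subUset sub1set sM andbT inE; apply/andP; split.
    by apply/existsP; exists a; apply/existsP; exists b; rewrite Gab /=.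
  have [] // := @trivIsetU1 _ [set a; b] M _ tM.
    move=> B BM; rewrite disjoint_sym disjoints_subset; apply/subsetP => x xB.
    have: x \in cover M by apply/bigcupP; exists B.
    rewrite cM !inE => x_s; apply/norP; split.
      by apply: contraNneq a_s => <-.
    by apply: contraNneq b_s => <-.
  by apply/negP => /(subsetP sM)/card_edge; rewrite cards0.
have ->: cover ([set a; b] |: M) = [set a; b] :|: cover M.
  by rewrite /cover bigcup_setU big_set1.
by rewrite cM; apply/setP => x; rewrite !inE -orbA.
Qed.

Lemma perfect_matching_of_paired s : paired s -> perm_eq s (enum V) ->
  exists M, perfect_matching G M.
Proof.
move=> ps ps_V; have us: uniq s by rewrite (perm_uniq ps_V) enum_uniq.
have [M mM cM] := matching_of_paired ps us; exists M.
rewrite /perfect_matching mM cM; apply/eqP/setP => x.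
by rewrite !inE (perm_mem ps_V) mem_enum.
Qed.

End Matching.

(** Deleting the ends of a perfect matching edge leaves a König-Egerváry graph
    of order [n - 2]; its matching number is at most half of that, so its
    independence number is at least the other half. *)
Lemma deming_indep_number_ge (V : finType) (D : sgraph V) :
  deming_condition D -> (exists M, perfect_matching D M) -> 0 < #|V| ->
  #|V| <= 2 * indep_number D + 2.
Proof.
move=> demD [M pM] /card_gt0P[v _].
have /andP[/andP[sM _] /eqP cM] := pM.
have: v \in cover M by rewrite cM inE.
case/bigcupP=> e eM _; have := subsetP sM e eM.
rewrite inE => /existsP[x /existsP[y /andP[Dxy /eqP def_e]]].
have nxy: x != y by apply: contraTneq Dxy => ->; rewrite adj_irrefl.
have KE: konig_egervary (induced D (~: [set x; y])).
  by apply: demD => //; exists M; rewrite -def_e.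
have := indep_number_induced D (~: [set x; y]).
have := matching_number_le (induced D (~: [set x; y])).
move: KE; rewrite /konig_egervary card_sig.
have := cardsC [set x; y]; rewrite cards2 nxy.
have ->: #|[pred z in ~: [set x; y]]| = #|~: [set x; y]| by apply: eq_card => z.
by rewrite -cardsE; lia.
Qed.

(** * Edges spanned by a vertex set *)

Section Arcs.
Variables (U : finType) (H : sgraph U).

(** Each edge is listed once, in the direction of increasing rank, so that sums
    over edges can be taken over ordered pairs. *)
Definition arcs : {set U * U} :=
  [set e | H e.1 e.2 && (enum_rank e.1 < enum_rank e.2)].

Lemma arcs_adj e : e \in arcs -> H e.1 e.2.
Proof. by rewrite inE => /andP[]. Qed.

Lemma arcs_inj e e' : e \in arcs -> e' \in arcs ->
  [set e.1; e.2] = [set e'.1; e'.2] -> e = e'.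
Proof.
case: e e' => [a b] [c d] /=; rewrite !inE /= => /andP[_ lt_ab] /andP[_ lt_cd].
case/set2_eq=> -[Ea Eb]; rewrite Ea Eb //.
by move: lt_ab lt_cd; rewrite Ea Eb; lia.
Qed.

Lemma arc_of_edge x y : H x y ->
  exists2 e, e \in arcs & (e = (x, y) \/ e = (y, x)).
Proof.
move=> Hxy; have nxy: x != y by apply: contraTneq Hxy => ->; rewrite adj_irrefl.
have: enum_rank x != enum_rank y :> nat.
  by apply: contra nxy => /eqP/val_inj/enum_rank_inj->.
rewrite neq_ltn => /orP[lt|lt]; [exists (x, y)|exists (y, x)]; try by [left|right];
  by rewrite inE /= lt ?(adj_sym H y) Hxy.
Qed.

(** Deleting from [X] one end of each edge it spans leaves an independent
    set. *)
Lemma card_le_indep_number_arcs (X : {set U}) :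
  #|X| <= indep_number H + #|[set e in arcs | (e.1 \in X) && (e.2 \in X)]|.
Proof.
have [n le_n] := ubnP #|X|; elim: n X le_n => // n IH X le_n.
have [indX|] := boolP (independent H X).
  by apply: leq_trans (indep_number_ge indX) (leq_addr _ _).
case/forall_inPn=> x xX /forall_inPn[y yX]; rewrite negbK => Hxy.
have [e e_arc def_e] := arc_of_edge Hxy.
have cX := cardsD1 x X; rewrite xX in cX.
set EX := [set e in arcs | _].
have eEX: e \in EX by rewrite inE e_arc; case: def_e => -> /=; rewrite xX yX.
have cEX := cardsD1 e EX; rewrite eEX in cEX.
have := IH (X :\ x); set EX' := [set e in arcs | _] => IHx.
have: EX' \subset EX :\ e.
  apply/subsetP => e'; rewrite !inE => /and3P[/andP[-> ->]].
  move=> /andP[nx1 ->] /andP[nx2 ->]; rewrite !andbT /=.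
  apply: contraTneq isT => E; move: nx1 nx2; rewrite E.
  by case: def_e => -> /=; rewrite eqxx.
by move/subset_leq_card; lia.
Qed.

End Arcs.

Lemma arcs_subrel (U : finType) (H' H : sgraph U) :
  subrel H' H -> arcs H' \subset arcs H.
Proof. by move=> sH; apply/subsetP => e; rewrite !inE => /andP[/sH-> ->]. Qed.

(** * Independent sets along paths *)

(** This records independence only where it is tested, on consecutive vertices
    of a path, so that the count applies to paths that survive an edge
    deletion. *)
Definition avoids (V : finType) (I : {set V}) : rel V :=
  [rel u v | ~~ ((u \in I) && (v \in I))].

(** The vertex [a] before the path enters the bound because, if it is in [I],
    the first vertex of [s] is not; this is what the induction carries. *)
Lemma count_path_avoids (V : finType) (I : {set V}) a s :
  path (avoids I) a s -> 2 * count (mem I) s + (a \in I) <= (size s).+1.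
Proof.
elim: s a => [|b s IH] a /=; first by case: (a \in I).
case/andP=> + /IH; rewrite /avoids /=.
by case: (a \in I); case: (b \in I) => //=; lia.
Qed.

Lemma count_sorted_avoids (V : finType) (I : {set V}) s :
  ~~ odd (size s) -> sorted (avoids I) s -> 2 * count (mem I) s <= size s.
Proof.
case: s => [|a s] //= ev /count_path_avoids.
by case: (a \in I) => /=; lia.
Qed.

Lemma count_sorted_avoids_ends (V : finType) (I : {set V}) a s b :
    ~~ odd (size s) -> sorted (avoids I) (a :: rcons s b) ->
  2 * count (mem I) s + 2 * ((a \in I) && (b \in I)) <= size s.
Proof.
move=> ev pth; have := count_path_avoids pth.
rewrite -cats1 count_cat size_cat /= addn0.
have: sorted (avoids I) s.
  by move: pth; rewrite /= rcons_path => /andP[/path_sorted].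
move/(count_sorted_avoids ev).
by case: (a \in I); case: (b \in I) => /=; lia.
Qed.

(** * Even subdivisions *)

Section EvenSubdivision.
Variables (U V : finType) (H : sgraph U) (G : sgraph V).
Variables (f : U -> V) (p : U -> U -> seq V).

Let full x y := f x :: rcons (p x y) (f y).

Hypothesis f_inj : injective f.
Hypothesis p_path : forall x y, H x y ->
  [/\ sorted G (full x y), uniq (full x y), ~~ odd (size (p x y)),
      p y x = rev (p x y) & forall z, f z \notin p x y].
Hypothesis p_disj : forall x y x' y' v, H x y -> H x' y' ->
  v \in p x y -> v \in p x' y' -> [set x; y] = [set x'; y'].
Hypothesis fp_cover :
  forall v, (exists x, v = f x) \/ (exists x y, H x y /\ v \in p x y).

Let interiors := flatten [seq p e.1 e.2 | e <- enum (arcs H)].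

Lemma mem_interiors v :
  v \in interiors -> exists2 e, e \in arcs H & v \in p e.1 e.2.
Proof. by case/flatten_mapP=> e; rewrite mem_enum; exists e. Qed.

Lemma branch_interiors_perm : perm_eq (map f (enum U) ++ interiors) (enum V).
Proof.
apply: uniq_perm; rewrite ?enum_uniq //.
  rewrite cat_uniq map_inj_uniq // enum_uniq /=; apply/andP; split.
    apply/hasPn => v /mem_interiors[e /arcs_adj He v_e].
    apply/negP => /mapP[x _ def_v]; have [_ _ _ _ /(_ x)] := p_path He.
    by rewrite -def_v v_e.
  apply: uniq_flatten_map; first exact: enum_uniq.
    move=> e; rewrite mem_enum => /arcs_adj/p_path[_ + _ _ _].
    by rewrite /= rcons_uniq => /and3P[].
  move=> e e'; rewrite !mem_enum => e_arc e'_arc v v_e v_e'.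
  by apply: (arcs_inj e_arc e'_arc); apply: p_disj v_e v_e'; apply: arcs_adj.
move=> v; rewrite mem_enum mem_cat; apply/orP.
have [[x ->]|[x [y [Hxy v_xy]]]] := fp_cover v.
  by left; rewrite map_f ?mem_enum.
right; have [e e_arc def_e] := arc_of_edge Hxy.
apply/flatten_mapP; exists e; first by rewrite mem_enum.
case: def_e => -> //=; have [_ _ _ -> _] := p_path Hxy.
by rewrite mem_rev.
Qed.

Lemma card_branch_interiors (A : {set V}) :
  #|A| = #|f @^-1: A| + \sum_(e in arcs H) count (mem A) (p e.1 e.2).
Proof.
have -> : #|A| = count (mem A) (enum V) by rewrite cardE enumT -size_filter.
rewrite -(permP branch_interiors_perm) count_cat count_map; congr (_ + _).
  rewrite enumT -size_filter cardE; congr size.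
  by apply: eq_filter => x; rewrite /= !inE.
by rewrite count_flatten -map_comp sumnE big_map big_enum.
Qed.

(** The vertices are listed path by path, taking the path with its ends exactly
    when the edge is matched in [H].  All pieces have even size, so consecutive
    entries of the list can be paired off. *)
Lemma has_perfect_matching_subdivision :
  (exists M0, perfect_matching H M0) -> exists M, perfect_matching G M.
Proof.
case=> M0 /andP[/andP[sM0 tM0] /eqP cM0].
pose sel (e : U * U) := [set e.1; e.2] \in M0.
pose ends := flatten [seq [:: e.1; e.2] | e <- enum (arcs H) & sel e].
pose pieces := flatten
  [seq (if sel e then full e.1 e.2 else p e.1 e.2) | e <- enum (arcs H)].
have ends_perm: perm_eq ends (enum U).
  apply: uniq_perm; rewrite ?enum_uniq //.
    apply: uniq_flatten_map; first by rewrite filter_uniq ?enum_uniq.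
      move=> e; rewrite mem_filter mem_enum => /andP[_ /arcs_adj He] /=.
      by rewrite inE andbT; apply: contraTneq He => ->; rewrite adj_irrefl.
    move=> e e'; rewrite !(mem_filter sel) !mem_enum.
    move=> /andP[sel_e e_arc] /andP[sel_e' e'_arc] x x_e x_e'.
    apply: (arcs_inj e_arc e'_arc); apply/eqP/idPn => ne.
    have := trivIsetP tM0 _ _ sel_e sel_e' ne.
    move/disjoint_setI0/setP/(_ x); rewrite !inE.
    by move: x_e x_e'; rewrite !inE => -> ->.
  move=> x; rewrite mem_enum; have: x \in cover M0 by rewrite cM0 inE.
  case/bigcupP=> d dM0 x_d; have := subsetP sM0 d dM0.
  rewrite inE => /existsP[a /existsP[b /andP[Hab /eqP def_d]]].
  have [e e_arc def_e] := arc_of_edge Hab.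
  have def_d': d = [set e.1; e.2] by case: def_e => -> //=; rewrite setUC.
  apply/flatten_mapP; exists e.
    by rewrite mem_filter mem_enum e_arc /sel -def_d' dM0.
  by move: x_d; rewrite def_d' !inE.
apply: (@perfect_matching_of_paired _ _ pieces).
  apply: paired_flatten_map => e; rewrite mem_enum => /arcs_adj/p_path.
  move=> [srt _ ev _ _]; case: (sel e).
    by apply: paired_sorted; rewrite //= size_rcons /= negbK.
  apply: paired_sorted => //.
  by move: srt; rewrite /full /= rcons_path => /andP[/path_sorted].
apply: perm_trans branch_interiors_perm.
apply: (@perm_trans _ (map f ends ++ interiors)); last first.
  by rewrite perm_cat2r perm_map.
apply/permP => a; rewrite /pieces /ends /interiors.
elim: (enum (arcs H)) => //= e s; rewrite !count_cat => ->.
rewrite [LHS]addnC; case: (sel e) => /=.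
  by rewrite -cats1 !count_cat /=; lia.
lia.
Qed.

(** Every subdivided edge of [H] is sparse in its interior, but only those
    coming from [H'] need be sparse up to their ends.  Taking [H'] to be [H]
    gives the bound for the subdivision, and taking it to be [H] minus an edge
    gives the bound after the deletion of an edge of the corresponding path. *)
Lemma card_avoids_subdivision (H' : sgraph U) (I : {set V}) :
    subrel H' H ->
    (forall x y, H x y -> sorted (avoids I) (p x y)) ->
    (forall x y, H' x y -> sorted (avoids I) (full x y)) ->
  2 * #|I| + #|U| <= 2 * indep_number H' + #|V|.
Proof.
move=> sH' avoidH avoidH'; set X := f @^-1: I.
have := card_le_indep_number_arcs H' X; set EX := [set e in _ | _] => le_X.
have cV : #|V| = #|[set: U]| + \sum_(e in arcs H) count (mem [set: V]) (p e.1 e.2).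
  by rewrite -cardsT card_branch_interiors preimsetT.
have cI := card_branch_interiors I.
have cEX: #|EX| = \sum_(e in arcs H) (e \in EX).
  rewrite -sum1_card big_mkcond [RHS]big_mkcond /=; apply: eq_bigr => e _.
  case: ifP; case: ifP => // /negP e_arc; rewrite inE => /andP[+ _].
  by move/(subsetP (arcs_subrel sH')).
have: \sum_(e in arcs H) (2 * count (mem I) (p e.1 e.2) + 2 * (e \in EX))
      <= \sum_(e in arcs H) count (mem [set: V]) (p e.1 e.2).
  apply: leq_sum => e /arcs_adj He; have [_ _ ev _ _] := p_path He.
  have ->: count (mem [set: V]) (p e.1 e.2) = size (p e.1 e.2).
    by rewrite (eq_count (a2 := predT)) ?count_predT // => v; rewrite /= inE.
  case: (boolP (e \in EX)) => [|_]; last first.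
    by rewrite addn0 count_sorted_avoids ?avoidH.
  rewrite inE => /andP[/arcs_adj H'e]; rewrite !inE => endsI.
  by have := count_sorted_avoids_ends ev (avoidH' _ _ H'e); rewrite endsI.
rewrite big_split -!big_distrr /= -cEX.
rewrite cV cI -/X -(cardsT U); move: le_X.
set a := \sum_(_ in _) count _ _; set b := \sum_(_ in _) count _ _.
lia.
Qed.

Lemma avoids_of_adj (G' : sgraph V) (I : {set V}) :
  independent G' I -> subrel G' (avoids I).
Proof.
move=> /independentP indI u v G'uv; apply/negP => /andP[uI vI].
by have := indI u v uI vI; rewrite G'uv.
Qed.

Lemma indep_number_subdivision :
  2 * indep_number G + #|U| <= 2 * indep_number H + #|V|.
Proof.
have [I indI ->] := indep_number_attained G; have sG := avoids_of_adj indI.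
have avoidF x y : H x y -> sorted (avoids I) (full x y).
  by case/p_path=> srt _ _ _ _; apply: sub_sorted srt.
apply: card_avoids_subdivision => // x y /avoidF.
by rewrite /full /= rcons_path => /andP[/path_sorted].
Qed.

(** The edge deleted is the first one of the path replacing [x0 y0], so that the
    interior of this path stays intact. *)
Lemma indep_number_subdivision_del x0 y0 : H x0 y0 ->
  exists u v, G u v /\
    2 * indep_number (del_edge G u v) + #|U|
      <= 2 * indep_number (del_edge H x0 y0) + #|V|.
Proof.
move=> H0; pose u := f x0; pose v := head (f y0) (p x0 y0).
(* The default [f y0] is the right value when the edge is not subdivided. *)
have [srt0 _ _ _ f_p0] := p_path H0.
exists u, v; split.
  by move: srt0; rewrite /full /v /u; case: (p x0 y0) => [|a s] /= /andP[].
have mem_full_f z x y : H x y -> f z \in full x y -> z \in [set x; y].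
  case/p_path=> _ _ _ _ /(_ z)/negPf f_p.
  by rewrite inE mem_rcons inE f_p orbF !inE !(inj_eq f_inj).
(* [uv] belongs to no path other than the one replacing [x0 y0]. *)
have ends_full x y : H x y -> u \in full x y -> v \in full x y ->
    [set x; y] = [set x0; y0].
  move=> Hxy /(mem_full_f _ _ _ Hxy) x0_xy.
  have n0: y0 != x0 by apply: contraTneq H0 => ->; rewrite adj_irrefl.
  rewrite /v; case def_p0: (p x0 y0) => [|a s] /=.
    move/(mem_full_f _ _ _ Hxy); move: x0_xy; rewrite !inE.
    by case/orP=> /eqP Ex; case/orP=> /eqP Ey; move: n0; rewrite Ex Ey ?eqxx // setUC.
  have a_p0: a \in p x0 y0 by rewrite def_p0 mem_head.
  rewrite inE mem_rcons inE => /or3P[/eqP Ea|/eqP Ea|a_p].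
  - by have := f_p0 x; rewrite -Ea a_p0.
  - by have := f_p0 y; rewrite -Ea a_p0.
  - exact: p_disj a_p a_p0.
have [I indI ->] := indep_number_attained (del_edge G u v).
have sG := avoids_of_adj indI.
apply: card_avoids_subdivision.
- by move=> x y /andP[].
- move=> x y Hxy; have [srt _ _ _ f_p] := p_path Hxy.
  have: sorted G (p x y).
    by move: srt; rewrite /full /= rcons_path => /andP[/path_sorted].
  apply: (sub_in_sorted (P := mem (p x y))); last by apply/allP.
  move=> a b a_p b_p Gab; apply: sG; rewrite /= /del_edge_rel /= Gab /=.
  apply: contraNneq (f_p x0) => E.
  have: u \in [set a; b] by rewrite E !inE eqxx.
  by rewrite !inE => /orP[]/eqP Eu; rewrite -/u Eu.
move=> x y /andP[Hxy ne]; have [srt _ _ _ _] := p_path Hxy.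
apply: (sub_in_sorted (P := mem (full x y))) srt; last by apply/allP.
move=> a b a_p b_p Gab; apply: sG; rewrite /= /del_edge_rel /= Gab /=.
apply: contra ne => /eqP E; apply/eqP; apply: ends_full => //.
  have: u \in [set a; b] by rewrite E !inE eqxx.
  by rewrite !inE => /orP[]/eqP Eu; rewrite Eu.
have: v \in [set a; b] by rewrite E !inE eqxx orbT.
by rewrite !inE => /orP[]/eqP Ev; rewrite Ev.
Qed.

End EvenSubdivision.

(** * The graphs K4 and T *)

Section Clique.
Variables (U : finType) (H : sgraph U).

Lemma card_indep_clique (X C : {set U}) :
    independent H X -> {in C &, forall x y, x != y -> H x y} ->
  #|X :&: C| <= 1.
Proof.
move=> /independentP indX cliC; apply/card_le1_eqP => x y.
rewrite !inE => /andP[xX xC] /andP[yX yC]; apply/eqP.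
by apply: contraNT (indX y x yX xX); apply: cliC.
Qed.

End Clique.

Lemma indep_number_K4 : indep_number K4 <= 1.
Proof.
apply: indep_number_le => X indX; rewrite -(setIT X).
exact: card_indep_clique indX _.
Qed.

Lemma indep_number_T_del : indep_number (del_edge T_graph (inord 2) (inord 3)) <= 2.
Proof.
apply: indep_number_le => X indX; rewrite -(cardsID [set x : 'I_6 | x < 3] X).
(* Edges inside a triangle are distinct from the bridge. *)
have ne (x y : 'I_6) : (x < 3) = (y < 3) -> [set x; y] != [set inord 2; inord 3 : 'I_6].
  by move=> Exy; apply/eqP => /set2_eq[]-[Ex Ey];
    move: Exy; rewrite Ex Ey !inordK.
apply: (@leq_add _ _ 1 1); rewrite ?setDE;
  apply: card_indep_clique indX _ => x y; rewrite !inE => x3 y3 nxy /=;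
  by rewrite /del_edge_rel /= /T_rel /= nxy ne /=; lia.
Qed.

Lemma perfect_matching_K4 : exists M, perfect_matching K4 M.
Proof.
apply: (@perfect_matching_of_paired _ _ (enum 'I_4)) => //.
by rewrite !enum_ordSl enum_ord0.
Qed.

Lemma perfect_matching_T : exists M, perfect_matching T_graph M.
Proof.
apply: (@perfect_matching_of_paired _ _ (enum 'I_6)) => //.
by rewrite !enum_ordSl enum_ord0.
Qed.

Lemma perfect_matching_subrel (V : finType) (S D : sgraph V) M :
  subrel S D -> perfect_matching S M -> perfect_matching D M.
Proof.
move=> sSD /andP[/andP[sM tM] cM]; rewrite /perfect_matching /matching tM cM !andbT.
apply: subset_trans sM _; apply/subsetP => e; rewrite !inE.
case/existsP=> x /existsP[y /andP[Sxy e_xy]].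
by apply/existsP; exists x; apply/existsP; exists y; rewrite sSD.
Qed.

(** * Critical Deming graphs *)

Lemma deming_subdivision_indep_number_ge (U V : finType) (H : sgraph U)
    (S D : sgraph V) :
    0 < #|U| -> (exists M, perfect_matching H M) ->
    subrel S D -> even_subdivision H S -> deming_condition D ->
  #|V| <= 2 * indep_number D + 2.
Proof.
move=> /card_gt0P[x _] pmH sSD [f [p [f_inj p_path p_disj cov _]]] demD.
apply: deming_indep_number_ge demD _ _; last by apply/card_gt0P; exists (f x).
have [M pM] := has_perfect_matching_subdivision f_inj p_path p_disj cov pmH.
by exists M; apply: perfect_matching_subrel pM.
Qed.

Theorem corollary2p10 (V : finType) (D : sgraph V) :
  alpha_critical D -> deming D -> even_subdivision K4 D.
Proof.
move=> critD [[[S [sSD subS]] demD]|[[S [sSD subS]] demD]].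
  have := deming_subdivision_indep_number_ge _ perfect_matching_K4 sSD subS demD.
  rewrite card_ord => /(_ isT) ge_D.
  have le_S: indep_number S <= indep_number D.
    have [f [p [f_inj p_path p_disj cov _]]] := subS.
    have := indep_number_subdivision f_inj p_path p_disj cov.
    by have := indep_number_K4; rewrite card_ord; lia.
  apply: even_subdivision_eqrel subS => //.
  exact: alpha_critical_subrel critD sSD le_S.
have := deming_subdivision_indep_number_ge _ perfect_matching_T sSD subS demD.
rewrite card_ord => /(_ isT) ge_D.
have [f [p [f_inj p_path p_disj cov _]]] := subS.
have bridge: T_graph (inord 2) (inord 3) by rewrite /= /T_rel /= -val_eqE /= !inordK.
have [u [v [Suv]]] := indep_number_subdivision_del f_inj p_path p_disj cov bridge.
have := indep_number_T_del; have := critD u v (sSD _ _ Suv).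
have: indep_number (del_edge D u v) <= indep_number (del_edge S u v).
  apply: indep_number_subrel => a b /andP[Sab ne].
  by rewrite /= /del_edge_rel /= sSD.
by rewrite card_ord; lia.
Qed.
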